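(* Let $\Omega\subset\mathbb{R}^3$ be a nonempty bounded open domain, $G,c>0$, $\mu\in L^1(\Omega)$ with $\mu\ge 0$, and $M=\int_\Omega\mu(x)\,dx>0$. Assume that there is no gravitational mass except that in $\Omega$. Let $B$ be a closed ball containing $\overline{\Omega}$ such that $$c^2\max_{u\in B}\Big\{\max_{x\in\overline{\Omega}}\|u-x\|\Big\}<2GM.$$ Then $B$ is a black hole. More precisely, if a photon enters the region $B$ at some time $t_0$ (that is, $u(t_0)\in B\setminus\overline{\Omega}$ and $\|u'(t_0)\|\le c$), then its position $u(t)$ satisfies $$\forall t\in[t_0,T_{max}),\quad \mathrm{dist}(u(t),\overline{\Omega})\le\frac{\max_{x\in\overline{\Omega}}\|u(t_0)-x\|}{1-\frac{c^2\max_{x\in\overline{\Omega}}\|u(t_0)-x\|}{2GM}}.$$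
   Context: $\|\cdot\|$ is the Euclidean norm on $\mathbb{R}^3$, $\mathrm{dist}(u,\overline{\Omega})=\min_{x\in\overline{\Omega}}\|u-x\|$, $G$ is the gravitational constant, $c$ the velocity of light, $\mu$ the local density of the mass $M$ in $\Omega$. Since there is no other mass, any point particle (in particular a photon, treated as a Newtonian particle) located outside $\overline{\Omega}$ moves according to $$(\ast)\qquad u''=-\int_\Omega\frac{G\mu(x)(u-x)}{\|u-x\|^3}\,dx .$$ The photon's trajectory $u:[t_0,T_{max})\to\mathbb{R}^3\setminus\overline{\Omega}$ is the maximal $C^2$ solution of $(\ast)$ with values in $\mathbb{R}^3\setminus\overline{\Omega}$ starting from its position and velocity at time $t_0$. A black hole is a massive body whose escape velocity exceeds $c$. Explicitly, $B$ is a black hole if for every $u_0\in B$ there is $V>c$ such that every trajectory starting at $u_0$ with initial speed less than $V$ is bounded. Here a trajectory starting at $u_0$ with initial speed less than $V$ is a continuous $u:[0,T)\to\mathbb{R}^3$, $0<T\le\infty$, with $u(0)=u_0$, such that for $t\in(0,T)$ one has $u(t)\notin\overline{\Omega}$, $u$ is $C^2$ and satisfies $(\ast)$, and $\limsup_{t\downarrow0}\|u'(t)\|<V$. *)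

(* Defs.v *)
From HB Require Import structures.
From mathcomp Require Import all_boot all_order all_algebra.
From mathcomp Require Import all_classical all_reals all_analysis.
Set Implicit Arguments.
Unset Strict Implicit.
Unset Printing Implicit Defensive.
Import Order.TTheory GRing.Theory Num.Theory.
Import numFieldNormedType.Exports.
Local Open Scope classical_set_scope.
Local Open Scope ring_scope.

(* R^3 is the iterated product, the only form of R^3 on which the library
   has a Lebesgue measure.  Its library norm is the max norm, which induces the
   Euclidean topology; metric notions go through enorm instead. *)
Notation R3 R := (R * R * R)%type.

Definition lebesgue3 (R : realType) :
    set (measurableTypeR R * measurableTypeR R * measurableTypeR R) -> \bar R :=
  ((@lebesgue_measure R \x @lebesgue_measure R) \x @lebesgue_measure R)%E.
HB.instance Definition _ (R : realType) := Measure.on (@lebesgue3 R).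

Section euclidean_space.
Context {R : realType}.
Implicit Types (u x a : R3 R) (A : set (R3 R)).

Definition enorm x : R := Num.sqrt (x.1.1 ^+ 2 + x.1.2 ^+ 2 + x.2 ^+ 2).

Definition closed_eball a (r : R) : set (R3 R) := [set x | enorm (x - a) <= r].

Definition ebounded A := exists K : R, forall x, A x -> enorm x <= K.

(* In the next three definitions A is compact and nonempty wherever they are
   used, so that sup and inf are a maximum and a minimum. *)
Definition max_on A (f : R3 R -> R) : R := sup (f @` A).

Definition max_edist A u : R := max_on A (fun x => enorm (u - x)).

Definition min_edist A u : R := inf [set enorm (u - x) | x in A].

Definition Rintegral3 A (f : R3 R -> R3 R) : R3 R :=
  (\int[@lebesgue3 R]_(x in A) (f x).1.1,
   \int[@lebesgue3 R]_(x in A) (f x).1.2,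
   \int[@lebesgue3 R]_(x in A) (f x).2).

End euclidean_space.

(* Derivatives relative to a time interval I: one-sided at an end point that
   belongs to I, two-sided at interior points, and independent of the values
   taken outside I. *)
Section derivative_within.
Context {R : realType} {V : normedModType R}.
Implicit Types (I : set R) (u : R -> V).

Definition derivable_within I u (t : R) : Prop :=
  cvg ((fun s => (s - t)^-1 *: (u s - u t)) @ within I t^').

Definition derive_within I u (t : R) : V :=
  lim ((fun s => (s - t)^-1 *: (u s - u t)) @ within I t^').

Definition C2_on I u : Prop :=
  [/\ forall t, I t -> derivable_within I u t,
      forall t, I t -> derivable_within I (derive_within I u) t &
      {within I, continuous (derive_within I (derive_within I u))}].

End derivative_within.

Section newtonian_gravity.
Context {R : realType}.
Variables (G : R) (Omega : set (R3 R)) (mu : R3 R -> R).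
Implicit Types (T : \bar R) (u : R -> R3 R).

Definition gravity (p : R3 R) : R3 R :=
  - Rintegral3 Omega (fun x => (G * mu x / enorm (p - x) ^+ 3) *: (p - x)).

Definition is_motion (I : set R) u : Prop :=
  [/\ forall t, I t -> ~ closure Omega (u t),
      C2_on I u &
      forall t, I t -> derive_within I (derive_within I u) t = gravity (u t)].

Definition itv_co (t0 : R) T : set R := [set t | t0 <= t /\ (t%:E < T)%E].
Definition itv_oo (t0 : R) T : set R := [set t | t0 < t /\ (t%:E < T)%E].

Definition is_maximal_motion (t0 : R) T u : Prop :=
  [/\ (t0%:E < T)%E,
      is_motion (itv_co t0 T) u &
      forall T' (w : R -> R3 R), (T <= T')%E -> is_motion (itv_co t0 T') w ->
        {in itv_co t0 T, w =1 u} -> T' = T].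

(* The starting point may lie on the boundary of Omega, hence the equation is
   required on (0, T) only and the initial speed is an upper limit. *)
Definition is_trajectory_from (u0 : R3 R) (V : R) T u : Prop :=
  [/\ (0 < T)%E,
      {within itv_co 0 T, continuous u},
      u 0 = u0,
      is_motion (itv_oo 0 T) u &
      (limf_esup (fun t => (enorm (derive_within (itv_oo 0 T) u t))%:E) 0^'+
        < V%:E)%E].

Definition is_black_hole (c : R) (B : set (R3 R)) : Prop :=
  forall u0 : R3 R, B u0 -> exists2 V : R, c < V &
    forall T u, is_trajectory_from u0 V T u -> ebounded (u @` itv_co 0 T).

End newtonian_gravity.

(* Main.v *)
Require Import Defs.
From mathcomp Require Import all_boot all_order all_algebra.
From mathcomp Require Import all_classical all_reals all_analysis.
From mathcomp Require Import measurable_realfun ring lra.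
Import Order.TTheory GRing.Theory Num.Theory.
Import numFieldNormedType.Exports.
Local Open Scope classical_set_scope.
Local Open Scope ring_scope.
Set Implicit Arguments.
Unset Strict Implicit.
Unset Printing Implicit Defensive.

(** The theorem is an energy estimate.  Outside the closure of [Omega] the
    energy [|u'|^2 / 2 - U(u)], with [U(p) = G * int mu(x) / |p - x| dx], is
    constant along a motion.  If all of [Omega] lies within distance [D] of the
    position at time [s], then [U(u s) >= G M / D]; if the speed at time [s] is
    at most [V], the kinetic energy at any later time [t] being nonnegative,
      [G M / D - V^2 / 2 <= U(u t) <= G M / dist(u t, closure Omega)].
    When [V^2 D < 2 G M] the left-hand side is positive, and solving for the
    distance gives the announced bound ([min_edist_bound]).  For a photon one
    takes [V = c] and [D] the largest distance from the point of entry.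

    For the black hole property, a starting point [u0] of the ball satisfies
    [c^2 d < 2 G M] with [d] the largest distance from [u0] to the closure of
    [Omega].  This strict inequality leaves room for some [V > c] and [D > d]
    with [V^2 D < 2 G M].  A trajectory may start on the boundary of [Omega],
    where the equation of motion is not available, so the estimate is applied
    from small positive times [s]: there the speed is below [V], and the
    distances from [u s] are below [D] by continuity; the resulting bound does
    not depend on [s].

    Conservation of energy rests on a pointwise estimate that is integrated
    afterwards.  The kernel [1 / |p - x|] agrees with its first-order Taylor
    polynomial up to an explicit multiple of [|q - p|^2], uniformly in [x], as
    long as [p] and [q] stay away from [Omega] ([inverse_distance_expansion]).
    Integrating this inequality shows that [gravity] is the gradient of [U] with
    a quadratic remainder ([potential_expansion]), and such an expansion can be
    composed with any curve that is differentiable relative to its time interval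
    ([has_derivative_comp]).  The integral enters only through the linearity and
    the monotonicity of [f |-> int mu f] on bounded continuous functions. *)

(** * Euclidean geometry of space *)

Section euclidean_geometry.
Context {R : realType}.
Implicit Types (x y h : R3 R).

Definition dot x y : R := x.1.1 * y.1.1 + x.1.2 * y.1.2 + x.2 * y.2.

Lemma dotDr x y z : dot x (y + z) = dot x y + dot x z.
Proof. rewrite /dot /=; ring. Qed.

Lemma dotZr k x y : dot x (k *: y) = k * dot x y.
Proof. rewrite /dot /= /GRing.scale /=; ring. Qed.

Lemma dotC x y : dot x y = dot y x.
Proof. rewrite /dot; ring. Qed.

Lemma sqr_enorm x : enorm x ^+ 2 = dot x x.
Proof. by rewrite sqr_sqrtr ?addr_ge0 ?sqr_ge0// /dot -!expr2. Qed.

Lemma enorm_ge0 x : 0 <= enorm x.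
Proof. exact: sqrtr_ge0. Qed.

Lemma enormN x : enorm (- x) = enorm x.
Proof. by rewrite /enorm /= !sqrrN. Qed.

Lemma enormB x y : enorm (x - y) = enorm (y - x).
Proof. by rewrite -enormN opprB. Qed.

(** Lagrange's identity writes the gap between the two squared sides as a sum
    of squares. *)
Lemma cauchy_schwarz x y : dot x y <= enorm x * enorm y.
Proof.
have [xy0|/ltW xy0] := leP 0 (dot x y); last first.
  by rewrite (le_trans xy0)// mulr_ge0// enorm_ge0.
rewrite -(@ler_pXn2r _ 2)// ?nnegrE ?mulr_ge0 ?enorm_ge0//.
rewrite exprMn !sqr_enorm -subr_ge0 /dot.
set L := (X in 0 <= X).
have -> : L = (x.1.1 * y.1.2 - x.1.2 * y.1.1) ^+ 2 +
   (x.1.2 * y.2 - x.2 * y.1.2) ^+ 2 + (x.2 * y.1.1 - x.1.1 * y.2) ^+ 2.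
  by rewrite /L; ring.
by rewrite !addr_ge0// sqr_ge0.
Qed.

Lemma norm_dot x y : `|dot x y| <= enorm x * enorm y.
Proof.
rewrite ler_norml cauchy_schwarz andbT lerNl -(enormN y).
by apply: le_trans (cauchy_schwarz _ _); rewrite -(scaleN1r y) dotZr mulN1r.
Qed.

Lemma sqr_enormD x y :
  enorm (x + y) ^+ 2 = enorm x ^+ 2 + 2 * dot x y + enorm y ^+ 2.
Proof. rewrite !sqr_enorm /dot /=; ring. Qed.

Lemma enormD x y : enorm (x + y) <= enorm x + enorm y.
Proof.
rewrite -(@ler_pXn2r _ 2)// ?nnegrE ?addr_ge0 ?enorm_ge0//.
have := cauchy_schwarz x y; rewrite sqr_enormD; nra.
Qed.

Lemma enorm_dist x y z : enorm (x - z) <= enorm (x - y) + enorm (y - z).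
Proof. by apply: le_trans (enormD _ _); rewrite addrA subrK. Qed.

Lemma norm_le_enorm x : `|x| <= enorm x.
Proof.
have le (a b c : R) : `|a| <= Num.sqrt (a ^+ 2 + b ^+ 2 + c ^+ 2).
  by rewrite -sqrtr_sqr ler_wsqrtr// -addrA lerDl addr_ge0 ?sqr_ge0.
case: x => [[a b] c]; rewrite /enorm !prod_normE /= !ge_max le /=.
by rewrite {1}(addrC (a ^+ 2)) le /= addrC addrA le.
Qed.

Lemma enorm_le_norm x : enorm x <= 2 * `|x|.
Proof.
case: x => [[a b] c]; set n := `|_ : R3 R|.
have n0 : 0 <= n by exact: normr_ge0.
have [an [bn cn]] : `|a| <= n /\ `|b| <= n /\ `|c| <= n.
  by rewrite /n !prod_normE /= !le_max !lexx !orbT.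
have sq d : `|d| <= n -> d ^+ 2 <= n ^+ 2.
  by move=> dn; rewrite -(@real_normK _ d) ?num_real// lerXn2r ?nnegrE.
rewrite -(@ler_pXn2r _ 2)// ?nnegrE ?enorm_ge0 ?mulr_ge0// sqr_enorm /dot /=.
have := sq _ an; have := sq _ bn; have := sq _ cn; nra.
Qed.

(** Write [A = |y|] and [B = |y + h|].  The identity
    [2 <y, h> = B^2 - A^2 - |h|^2] eliminates the angle, and the quantity under
    the absolute value becomes
      [(B - A)^2 (1 / (A^2 B) + 1 / (2 A^3)) - |h|^2 / (2 A^3)].
    It is of second order because [|B - A| <= |h|]. *)
Lemma inverse_distance_expansion (delta : R) y h :
  0 < delta -> delta <= enorm y -> delta <= enorm (y + h) ->
  `|(enorm (y + h))^-1 - (enorm y)^-1 + dot y h / enorm y ^+ 3|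
    <= 2 / delta ^+ 3 * enorm h ^+ 2.
Proof.
move=> d0 dy dyh.
have yhE := sqr_enormD y h.
(* the reverse triangle inequality, squared *)
have cs : (enorm (y + h) - enorm y) ^+ 2 <= enorm h ^+ 2.
  have e : dot y (y + h) = enorm y ^+ 2 + dot y h by rewrite sqr_enorm dotDr.
  by have := cauchy_schwarz y (y + h); nra.
move: dy dyh yhE cs; set A := enorm y; set B := enorm (y + h).
set H := enorm h ^+ 2; set d := dot y h => dy dyh yhE cs.
have A0 : 0 < A by exact: lt_le_trans dy.
have B0 : 0 < B by exact: lt_le_trans dyh.
have H0 : 0 <= H by exact: sqr_ge0.
have -> : B^-1 - A^-1 + d / A ^+ 3 =
    (B - A) ^+ 2 * (A ^- 2 / B + A ^- 3 / 2) - H * (A ^- 3 / 2).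
  have -> : d = (B ^+ 2 - A ^+ 2 - H) / 2 by rewrite yhE; field.
  by field; rewrite !gt_eqF.
have A3 : A ^- 3 <= delta ^- 3.
  by rewrite lef_pV2 ?posrE ?exprn_gt0// lerXn2r// nnegrE ltW.
have A2B : A ^- 2 / B <= delta ^- 3.
  rewrite -invfM lef_pV2 ?posrE ?mulr_gt0 ?exprn_gt0// exprSr.
  by rewrite ler_pM ?exprn_ge0 ?(ltW d0)// lerXn2r// nnegrE ltW.
have A30 : 0 <= A ^- 3 by rewrite invr_ge0 exprn_ge0 ?ltW.
have A2B0 : 0 <= A ^- 2 / B by rewrite mulr_ge0 ?invr_ge0 ?exprn_ge0 ?ltW.
move: A3 A2B A30 A2B0 cs H0 (sqr_ge0 (B - A)).
set p := A ^- 3; set q := A ^- 2 / B; set k := delta ^- 3.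
set s := (B - A) ^+ 2.
by move=> *; rewrite ler_norml; apply/andP; split; nra.
Qed.

End euclidean_geometry.

(** * Measurability in space *)

Section open_measurable_R3.
Context {R : realType}.
Local Notation mR3 :=
  (measurableTypeR R * measurableTypeR R * measurableTypeR R)%type.
Implicit Types (A : set (R3 R)).

(** An open set is the union of the balls of the maximum norm that it contains
    among those with rational centre and radius [1 / (n + 1)].  There are
    countably many of them, and each is a product of intervals. *)
Lemma open_measurable_R3 A : open A -> measurable (A : set mR3).
Proof.
move=> oA.
pose box (q : rat * rat * rat * nat) : set (R3 R) :=
  ball (ratr q.1.1.1 : R, ratr q.1.1.2 : R, ratr q.1.2 : R) q.2.+1%:R^-1.
have mbox q : measurable (box q : set mR3).
  rewrite /box; set e := _^-1.
  have -> : ball (ratr q.1.1.1 : R, ratr q.1.1.2 : R, ratr q.1.2 : R) e =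
      (ball (ratr q.1.1.1 : R) e `*` ball (ratr q.1.1.2 : R) e) `*`
      ball (ratr q.1.2 : R) e by [].
  by apply: measurableX; [apply: measurableX|]; exact: measurable_ball.
have -> : A = \bigcup_q (if `[< box q `<=` A >] then box q else set0).
  apply/seteqP; split=> [x Ax|x [q _]]; last by case: asboolP => // bA /bA.
  have /nbhs_ballP[e /= e0 eA] : nbhs x A by exact: open_nbhs_nbhs.
  (* halving the radius leaves room to move the centre to a rational point *)
  have e20 : 0 < e / 2 by rewrite divr_gt0.
  have [n _ /(_ n (leqnn n)) /= ne] := near_infty_natSinv_lt (PosNum e20).
  have approx (y : R) : exists q : rat, `|y - ratr q| < n.+1%:R^-1.
    have yn : y - n.+1%:R^-1 < y by rewrite ltrBlDr ltrDl invr_gt0.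
    have [q] := rat_in_itvoo yn.
    rewrite in_itv /= => /andP[q1 q2]; exists q.
    by rewrite ger0_norm ?subr_ge0 ?(ltW q2)// ltrBlDr -ltrBlDl.
  have [q1 h1] := approx x.1.1; have [q2 h2] := approx x.1.2.
  have [q3 h3] := approx x.2.
  have xb : box (q1, q2, q3, n) x.
    by split; [split|]; rewrite /ball /= distrC.
  exists (q1, q2, q3, n) => //; case: asboolP => // -[] y yb; apply: eA.
  move: xb yb; rewrite /box /=; set z : R3 R := (_, _, _) => xb yb.
  have xb2 := le_ball (ltW ne) xb; have yb2 := le_ball (ltW ne) yb.
  exact: ball_splitl (ball_sym xb2) (ball_sym yb2).
apply: countable_bigcupT_measurable => // q.
by case: ifP.
Qed.


Lemma continuous_measurable_fun_R3 A (f : R3 R -> R) : open A ->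
  (forall x, A x -> {for x, continuous f}) ->
  measurable_fun (A : set mR3) (f : mR3 -> R).
Proof.
move=> oA cf; apply: (measurability _ (RGenOpens.measurableE R)).
move=> _ [_ [a [b ->] <-]]; apply: open_measurable_R3.
rewrite openE => x /= [Ax fx]; apply: filterI; first exact: open_nbhs_nbhs.
by apply: cf => //; apply: open_nbhs_nbhs; split=> //; exact: interval_open.
Qed.

End open_measurable_R3.

(** * Integration against the mass density *)

Section mass_integral.
Context {R : realType}.
Variables (Omega : set (R3 R)) (mu : R3 R -> R).
Hypothesis Omega_open : open Omega.
Hypothesis mu_int : (@lebesgue3 R).-integrable Omega (EFin \o mu).
Hypothesis mu_ge0 : {ae @lebesgue3 R, forall x, Omega x -> 0 <= mu x}.
Local Notation mR3 :=
  (measurableTypeR R * measurableTypeR R * measurableTypeR R)%type.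
Implicit Types (f g : R3 R -> R).

(** Bounded and continuous on [Omega]: a convenient class of integrands, closed
    under sums and products, whose products with [mu] are integrable. *)
Definition tame f := (forall x, Omega x -> {for x, continuous f}) /\
  exists K, forall x, Omega x -> `|f x| <= K.

Definition mass_int f := \int[@lebesgue3 R]_(x in Omega) (mu x * f x).

Let mOmega : measurable (Omega : set mR3).
Proof. exact: open_measurable_R3. Qed.

Lemma tame_integrable f : tame f ->
  (@lebesgue3 R).-integrable Omega (fun x => (mu x * f x)%:E).
Proof.
move=> [cf [K fK]].
apply: (integrableMl mOmega mu_int).
  exact: continuous_measurable_fun_R3.
exists K; split; first exact: num_real.
by move=> L KL x /= Ox; exact: le_trans (fK x Ox) (ltW KL).
Qed.

Lemma tame_cst k : tame (cst k).
Proof.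
by split; [move=> x _; exact: cvg_cst|exists `|k|].
Qed.

Lemma tameD f g : tame f -> tame g -> tame (f \+ g).
Proof.
move=> [cf [K fK]] [cg [L gL]]; split=> [x Ox|].
  by apply: cvgD; [exact: cf|exact: cg].
exists (K + L) => x Ox; apply: le_trans (ler_normD _ _) _.
by rewrite lerD ?fK ?gL.
Qed.

Lemma tameM f g : tame f -> tame g -> tame (f \* g).
Proof.
move=> [cf [K fK]] [cg [L gL]]; split=> [x Ox|].
  by apply: cvgM; [exact: cf|exact: cg].
by exists (K * L) => x Ox; rewrite normrM ler_pM ?fK ?gL.
Qed.

Lemma mass_intD f g : tame f -> tame g ->
  mass_int (f \+ g) = mass_int f + mass_int g.
Proof.
move=> tf tg; rewrite /mass_int -RintegralD //; try exact: tame_integrable.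
by apply: eq_Rintegral => x _; rewrite mulrDr.
Qed.

Lemma mass_intZ k f : tame f ->
  mass_int (fun x => k * f x) = k * mass_int f.
Proof.
move=> tf; rewrite /mass_int -RintegralZl//; last exact: tame_integrable.
by apply: eq_Rintegral => x _; rewrite mulrCA.
Qed.

(** The density is only nonnegative almost everywhere, so [mu] is first replaced
    by [|mu|], which does not change the integral. *)
Lemma mass_int_ge0 f : tame f -> (forall x, Omega x -> 0 <= f x) ->
  0 <= mass_int f.
Proof.
move=> tf f0; have := tame_integrable tf; have [cf _] := tf.
have mf := continuous_measurable_fun_R3 Omega_open cf.
move=> /(measurable_int _) mmuf.
rewrite (_ : mass_int f = \int[@lebesgue3 R]_(x in Omega) (`|mu x| * f x)).
  by apply: Rintegral_ge0 => x Ox; rewrite mulr_ge0 ?f0.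
congr fine; apply: ae_eq_integral => //.
  apply/measurable_EFinP; apply: measurable_funM => //.
  apply: measurableT_comp => //; apply/measurable_EFinP.
  exact: measurable_int mu_int.
have Fae := @ae_filter_ringOfSetsType _ _ _ (@lebesgue3 R).
apply: (@filterS _ _ Fae) mu_ge0 => x mu0 Ox; rewrite ger0_norm ?mu0//.
Qed.

Lemma le_mass_int f g : tame f -> tame g ->
  (forall x, Omega x -> f x <= g x) -> mass_int f <= mass_int g.
Proof.
move=> tf tg fg; have tNf := tameM (tame_cst (-1)) tf.
have := @mass_int_ge0 (g \+ (fun x => -1 * f x)) (tameD tg tNf).
rewrite mass_intD// mass_intZ// mulN1r subr_ge0; apply => x Ox.
by rewrite /= mulN1r subr_ge0 fg.
Qed.

Lemma mass_int_cst k : mass_int (cst k) = k * mass_int (cst 1).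
Proof.
rewrite -mass_intZ//; last exact: tame_cst.
by congr mass_int; apply/funext => x; rewrite mulr1.
Qed.

End mass_integral.

(** * The Newtonian potential *)

Section dot_limits.
Context {R : realType}.
Implicit Types (x y : R3 R).

Lemma cvg_dot (T : Type) (F : set_system T) {FF : Filter F}
    (f g : T -> R3 R) x y :
  f @ F --> x -> g @ F --> y -> (fun t => dot (f t) (g t)) @ F --> dot x y.
Proof.
have comps (h : T -> R3 R) (z : R3 R) : h @ F --> z ->
    [/\ (fun t => (h t).1.1) @ F --> z.1.1, (fun t => (h t).1.2) @ F --> z.1.2
      & (fun t => (h t).2) @ F --> z.2].
  move=> hz.
  have fst_z : (fun y : R3 R => y.1) @ z --> z.1 by exact: cvg_fst.
  have snd_z : (fun y : R3 R => y.2) @ z --> z.2 by exact: cvg_snd.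
  have fst_z1 : (fun y : R * R => y.1) @ z.1 --> z.1.1 by exact: cvg_fst.
  have snd_z1 : (fun y : R * R => y.2) @ z.1 --> z.1.2 by exact: cvg_snd.
  split; [apply: cvg_comp fst_z1|apply: cvg_comp snd_z1|exact: cvg_comp snd_z].
    exact: cvg_comp fst_z.
  exact: cvg_comp fst_z.
move=> /comps[f1 f2 f3] /comps[g1 g2 g3].
by apply: cvgD; [apply: cvgD|]; apply: cvgM.
Qed.

Lemma cvg_enorm (T : Type) (F : set_system T) {FF : Filter F}
    (f : T -> R3 R) x :
  f @ F --> x -> (fun t => enorm (f t)) @ F --> enorm x.
Proof.
by move=> fx; apply: cvg_comp (cvg_dot fx fx) _; exact: sqrt_continuous.
Qed.

End dot_limits.

Section newtonian_potential.
Context {R : realType}.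
Variables (G : R) (Omega : set (R3 R)) (mu : R3 R -> R).
Hypothesis G_gt0 : 0 < G.
Hypothesis Omega_open : open Omega.
Hypothesis mu_int : (@lebesgue3 R).-integrable Omega (EFin \o mu).
Hypothesis mu_ge0 : {ae @lebesgue3 R, forall x, Omega x -> 0 <= mu x}.
Implicit Types (p q e : R3 R) (delta : R).
Local Notation mass_int := (mass_int Omega mu).

(** Every estimate below is made at points that keep a distance from [Omega],
    where the integrands are bounded. *)
Definition far delta p := forall x, Omega x -> delta <= enorm (p - x).

Definition inv_dist p x := (enorm (p - x))^-1.

(** The derivative of [inv_dist] at [p] in the direction [e] is
    [- dipole p e x]. *)
Definition dipole p e x := dot (p - x) e / enorm (p - x) ^+ 3.

Definition potential p := G * mass_int (inv_dist p).

Lemma tame_inv_dist delta p : 0 < delta -> far delta p ->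
  tame Omega (inv_dist p).
Proof.
move=> d0 dp; split=> [x Ox|].
  apply: cvgV; first by rewrite gt_eqF// (lt_le_trans d0)// dp.
  by apply: cvg_enorm; apply: cvgB => //; exact: cvg_cst.
exists delta^-1 => x Ox; have dpx := dp x Ox.
by rewrite normfV ger0_norm ?enorm_ge0// lef_pV2 ?posrE// (lt_le_trans d0).
Qed.

(** Cauchy-Schwarz bounds the numerator by [|p - x| |e|], so that the dipole is
    at most [|e| / |p - x|^2]. *)
Lemma tame_dipole delta p e : 0 < delta -> far delta p ->
  tame Omega (dipole p e).
Proof.
move=> d0 dp; have [cV [K VK]] := tame_inv_dist d0 dp.
have -> : dipole p e =
    (fun x => dot (p - x) e) \* (fun x => inv_dist p x ^+ 3).
  by apply/funext => x; rewrite /= /inv_dist exprVn.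
split=> [x Ox|].
  apply: cvgM; last first.
    by apply: cvgM; [exact: cV|apply: cvgM; exact: cV].
  by apply: cvg_dot; [apply: cvgB => //; exact: cvg_cst|exact: cvg_cst].
exists (enorm e * K ^+ 2) => x Ox.
have n0 : 0 < enorm (p - x) by exact: lt_le_trans d0 (dp x Ox).
rewrite normrM.
apply: le_trans (_ : enorm (p - x) * enorm e * `|inv_dist p x ^+ 3| <= _).
  by rewrite ler_wpM2r ?norm_dot.
rewrite exprSr normrM (_ : _ * _ = enorm e * `|inv_dist p x ^+ 2|).
  rewrite normrX; apply: ler_wpM2l; first exact: enorm_ge0.
  by rewrite lerXn2r ?nnegrE ?(le_trans _ (VK x Ox)) ?VK.
rewrite mulrCA mulrAC (ger0_norm (x := inv_dist p x)) ?invr_ge0 ?enorm_ge0//.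
rewrite {2}/inv_dist; set n2 := `|_|; field; rewrite gt_eqF//.
Qed.

(** The field is defined coordinate by coordinate; each coordinate is the case
    of a basis vector [e], and the general case follows by linearity. *)
Lemma dot_gravity delta p e : 0 < delta -> far delta p ->
  dot (gravity G Omega mu p) e = - (G * mass_int (dipole p e)).
Proof.
move=> d0 dp; have td := @tame_dipole _ _ _ d0 dp.
have tZ k f : tame Omega f -> tame Omega (fun x => k * f x).
  by move=> tf; apply: (tameM (tame_cst _ k) tf).
have comp b c : (forall x, dot x b = c x) ->
  \int[@lebesgue3 R]_(x in Omega)
    (c ((G * mu x / enorm (p - x) ^+ 3) *: (p - x))) =
  G * mass_int (dipole p b).
  move=> bc; rewrite -(mass_intZ Omega_open mu_int)//.
  apply: eq_Rintegral => x _.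
  by rewrite -bc dotC dotZr dotC /dipole; ring.
rewrite /gravity /dot /=.
rewrite (comp (1, 0, 0) (fun x => x.1.1)) /=; last first.
  by move=> x; rewrite /dot /=; ring.
rewrite (comp (0, 1, 0) (fun x => x.1.2)) /=; last first.
  by move=> x; rewrite /dot /=; ring.
rewrite (comp (0, 0, 1) (fun x => x.2)) /=; last first.
  by move=> x; rewrite /dot /=; ring.
have -> : dipole p e = (fun x => e.1.1 * dipole p (1, 0, 0) x) \+
    (fun x => e.1.2 * dipole p (0, 1, 0) x) \+
    (fun x => e.2 * dipole p (0, 0, 1) x).
  by apply/funext => x; rewrite /dipole /dot /=; ring.
have t1 := tZ e.1.1 _ (td (1, 0, 0)); have t2 := tZ e.1.2 _ (td (0, 1, 0)).
have t3 := tZ e.2 _ (td (0, 0, 1)).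
rewrite (mass_intD Omega_open mu_int (tameD t1 t2) t3).
rewrite (mass_intD Omega_open mu_int t1 t2).
rewrite !(mass_intZ Omega_open mu_int)//; ring.
Qed.

(** [gravity] is the gradient of [potential], with a quadratic remainder that is
    uniform over the points at distance at least [delta] from [Omega]: the
    pointwise expansion of the kernel is integrated against [mu]. *)
Lemma potential_expansion delta p q : 0 < delta -> far delta p -> far delta q ->
  `|potential q - potential p - dot (gravity G Omega mu p) (q - p)| <=
  G * (2 / delta ^+ 3 * mass_int (cst 1)) * enorm (q - p) ^+ 2.
Proof.
move=> d0 dp dq; rewrite (dot_gravity _ d0 dp) /potential.
set h := q - p.
have tN : tame Omega (fun x => -1 * inv_dist p x).
  exact: tameM (tame_cst _ _) (tame_inv_dist d0 dp).
have tq := tame_inv_dist d0 dq.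
have td := tame_dipole h d0 dp.
pose k := inv_dist q \+ (fun x => -1 * inv_dist p x) \+ dipole p h.
have tk : tame Omega k by do 2 apply: tameD => //.
have -> : G * mass_int (inv_dist q) - G * mass_int (inv_dist p) -
    - (G * mass_int (dipole p h)) = G * mass_int k.
  rewrite /k (mass_intD Omega_open mu_int (tameD tq tN) td).
  rewrite (mass_intD Omega_open mu_int tq tN).
  rewrite (mass_intZ Omega_open mu_int) //; first by ring.
  exact: tame_inv_dist dp.
rewrite normrM gtr0_norm// -mulrA ler_pM2l//.
pose C := 2 / delta ^+ 3 * enorm h ^+ 2.
have kC x : Omega x -> `|k x| <= C.
  move=> Ox.
  have := @inverse_distance_expansion _ delta (p - x) h d0 (dp x Ox).
  rewrite (_ : p - x + h = q - x); last by rewrite /h addrC addrA subrK.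
  by rewrite /k /inv_dist /= mulN1r; apply; exact: dq.
rewrite mulrAC -/C ler_norml -mulNr -!(mass_int_cst Omega_open mu_int).
by apply/andP; split; apply: le_mass_int => //; try exact: tame_cst;
  move=> x /kC; rewrite ler_norml => /andP[].
Qed.

Lemma potential_ge delta d p : 0 < delta -> far delta p ->
  (forall x, Omega x -> enorm (p - x) <= d) ->
  G * mass_int (cst 1) / d <= potential p.
Proof.
move=> d0 dp pd; rewrite -mulrA ler_pM2l// mulrC -mass_int_cst//.
apply: le_mass_int => //; [exact: tame_cst|exact: tame_inv_dist dp|].
move=> x Ox; have px0 := lt_le_trans d0 (dp x Ox).
by rewrite lef_pV2 ?posrE ?pd// (lt_le_trans px0)// pd.
Qed.

Lemma potential_le delta p : 0 < delta -> far delta p ->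
  potential p <= G * mass_int (cst 1) / delta.
Proof.
move=> d0 dp; rewrite -mulrA ler_pM2l// mulrC -mass_int_cst//.
apply: le_mass_int => //; [exact: tame_inv_dist dp|exact: tame_cst|].
move=> x Ox; have px0 := lt_le_trans d0 (dp x Ox).
by rewrite lef_pV2 ?posrE ?dp.
Qed.

End newtonian_potential.

(** * Derivatives relative to a time interval *)

Section derivatives_within.
Context {R : realType}.
Implicit Types (I : set R) (t : R).

Definition has_derivative (V : normedModType R) I (u : R -> V) t (v : V) :=
  (fun s => (s - t)^-1 *: (u s - u t)) @ within I t^' --> v.

Lemma near_within_neq I t : \forall s \near within I t^', s != t.
Proof. by rewrite near_withinE; apply: filterS (nbhs_dnbhs_neq t). Qed.

Lemma cvg_subr_within I t : (fun s => s - t) @ within I t^' --> (0 : R).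
Proof.
apply/subr_cvg0; apply: cvg_trans (cvg_within _) _.
exact: nbhs_dnbhs.
Qed.

Lemma has_derivative_cvg (V : normedModType R) I (u : R -> V) t v :
  has_derivative I u t v -> u @ within I t^' --> u t.
Proof.
move=> uv; apply/subr_cvg0.
have st_uv : (fun s => (s - t) *: ((s - t)^-1 *: (u s - u t)))
    @ within I t^' --> (0 : V).
  by rewrite -(scale0r v); apply: cvgZ uv; exact: cvg_subr_within.
apply: cvg_trans st_uv; apply: near_eq_cvg; near=> s.
have st : s != t by near: s; exact: near_within_neq.
by rewrite scalerA mulfV ?scale1r// subr_eq0.
Unshelve. all: by end_near. Qed.

Lemma has_derivative_subset (V : normedModType R) I J (u : R -> V) t v :
  J `<=` I -> has_derivative I u t v -> has_derivative J u t v.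
Proof.
move=> JI uv; apply: (cvg_trans _ uv); apply: cvg_fmap2; exact: within_subset.
Qed.

Lemma has_derivativeB (V : normedModType R) I (f g : R -> V) t v w :
  has_derivative I f t v -> has_derivative I g t w ->
  has_derivative I (f \- g) t (v - w).
Proof.
move=> fv gw.
have fg : (fun s => (s - t)^-1 *: (f s - f t) - (s - t)^-1 *: (g s - g t))
    @ within I t^' --> v - w by exact: cvgB.
apply: cvg_trans fg; apply: near_eq_cvg; near=> s.
rewrite /= -scalerBr; congr (_ *: _).
by rewrite !opprB addrACA [RHS]addrACA (addrC (- f t)).
Unshelve. all: by end_near. Qed.

(** The mean value theorem, applied with two-sided derivatives in the interior
    and mere continuity at the end points. *)
Lemma has_derivative0_cst (f : R -> R) (a b : R) : a <= b ->
  (forall t, t \in `[a, b] -> has_derivative [set` `[a, b]] f t 0) -> f a = f b.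
Proof.
rewrite le_eqVlt => /predU1P[->//|ab] df.
have fcont : {within `[a, b], continuous f}.
  apply/subspace_continuousP => t tab; apply/cvgrPdist_lt => e e0.
  have := has_derivative_cvg (df t tab) => /cvgrPdist_lt /(_ e e0).
  rewrite !near_withinE; apply: filterS => s fs sab.
  by have [->|/fs] := eqVneq s t; [rewrite subrr normr0|exact].
have fder t : t \in `]a, b[ -> is_derive t 1 f 0.
  move=> tab.
  have dft : (fun h => h^-1 *: (f (h + t) - f t)) @ (0 : R)^' --> (0 : R).
    have tab' : t \in `[a, b] by apply: subset_itv_oo_cc tab.
    apply/cvgrPdist_lt => e e0.
    have := df t tab' => /cvgrPdist_lt /(_ e e0).
    have It : \forall s \near t, s \in `[a, b].
      by apply: filterS (near_in_itvoo tab) => s; exact: subset_itv_oo_cc.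
    rewrite !near_withinE => fe.
    have : \forall s \near t, s != t -> `|0 - (s - t)^-1 *: (f s - f t)| < e.
      by apply: filterS2 fe It => s fs sI st; exact: fs.
    rewrite (near_shift 0); apply: filterS => h /= + h0.
    rewrite subr0 addrK; apply.
    by rewrite -subr_eq0 addrK.
  have dft' : (fun h => h^-1 *: ((f \o shift t) (h *: 1) - f t))
      @ (0 : R)^' --> (0 : R).
    by under eq_fun do rewrite /= [_ *: 1]mulr1.
  apply: DeriveDef; first by apply/cvg_ex; exists 0.
  exact: cvg_lim dft'.
have [c _] := MVT ab fder fcont.
by rewrite mul0r => /eqP; rewrite subr_eq0 => /eqP.
Qed.

(** The difference quotient of [F \o u] differs from [dot g] of the difference
    quotient [q] of [u] by at most [K |s - t| |q s|^2], which tends to [0]. *)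
Lemma has_derivative_comp I (u : R -> R3 R) t (v g : R3 R) (F : R3 R -> R) K :
  (\forall s \near within I t^',
     `|F (u s) - F (u t) - dot g (u s - u t)| <= K * enorm (u s - u t) ^+ 2) ->
  has_derivative I u t v -> has_derivative I (F \o u) t (dot g v).
Proof.
move=> Fu uv; rewrite /has_derivative /=.
pose q s := (s - t)^-1 *: (u s - u t); rewrite -/q in uv.
pose r s := K * (`|s - t| * enorm (q s) ^+ 2).
have r0 : r @ within I t^' --> (0 : R).
  have -> : (0 : R) = K * (`|0 : R| * enorm v ^+ 2).
    by rewrite normr0 mul0r mulr0.
  apply: cvgM; first exact: cvg_cst.
  apply: cvgM; first by apply: cvg_norm; exact: cvg_subr_within.
  by apply: cvgM; exact: cvg_enorm.
have gq : (fun s => dot g (q s)) @ within I t^' --> dot g v.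
  by apply: cvg_dot => //; exact: cvg_cst.
apply: (@squeeze_cvgr _ _ _ _ (fun s => dot g (q s) - r s)
  (fun s => dot g (q s) + r s)).
- near=> s.
  have st : s - t != 0 by rewrite subr_eq0; near: s; exact: near_within_neq.
  rewrite -ler_distl.
  have -> : (s - t)^-1 *: (F (u s) - F (u t)) - dot g (q s) =
     (s - t)^-1 * (F (u s) - F (u t) - dot g (u s - u t)).
    by rewrite /q dotZr [in RHS]mulrBr.
  have -> : r s = `|(s - t)^-1| * (K * enorm (u s - u t) ^+ 2).
    rewrite /r sqr_enorm /q dotZr dotC dotZr -sqr_enorm.
    have -> : `|s - t| = (s - t) ^+ 2 * `|(s - t)^-1|.
      by rewrite -real_normK ?num_real// normfV expr2 mulfK// normr_eq0.
    by field.
  rewrite normrM ler_wpM2l//; near: s; exact: Fu.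
- by rewrite -[X in _ --> X]subr0; exact: cvgB.
- by rewrite -[X in _ --> X]addr0; exact: cvgD.
Unshelve. all: by end_near. Qed.

End derivatives_within.

(** * Conservation of energy *)

Section energy.
Context {R : realType}.
Variables (G : R) (Omega : set (R3 R)) (mu : R3 R -> R).
Hypothesis G_gt0 : 0 < G.
Hypothesis Omega_open : open Omega.
Hypothesis mu_int : (@lebesgue3 R).-integrable Omega (EFin \o mu).
Hypothesis mu_ge0 : {ae @lebesgue3 R, forall x, Omega x -> 0 <= mu x}.
Implicit Types (I : set R) (u : R -> R3 R) (s t : R).

Lemma far_near p : ~ closure Omega p ->
  exists2 delta, 0 < delta & \forall q \near p, far Omega delta q.
Proof.
move=> /existsNP[A] /not_implyP[/nbhs_ballP[e /= e0 eA] OA].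
exists (e / 2); first by rewrite divr_gt0.
have : nbhs p (ball p (e / 2)) by apply: nbhsx_ballx; rewrite divr_gt0.
apply: filterS => q pq x Ox; rewrite leNgt; apply/negP => qx; apply: OA.
exists x; split=> //; apply: eA; apply: ball_split pq _.
by rewrite -ball_normE /=; exact: le_lt_trans (norm_le_enorm _) qx.
Qed.

Definition energy I u t :=
  enorm (derive_within I u t) ^+ 2 / 2 - potential G Omega mu (u t).

(** By Newton's equation the kinetic term varies at the rate [<u', gravity u>],
    which is also the rate of the potential term. *)
Lemma energy_has_derivative0 I u t : is_motion G Omega mu I u -> I t ->
  has_derivative I (energy I u) t 0.
Proof.
move=> [nO [du dv _] newton] It.
have u' : has_derivative I u t (derive_within I u t) by exact: du.
have v' : has_derivative I (derive_within I u) t (gravity G Omega mu (u t)).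
  rewrite -(newton t It); exact: dv.
have [delta d0 fard] := far_near (nO t It).
have farut : far Omega delta (u t) := nbhs_singleton fard.
(* the kinetic energy is quadratic, so its remainder is known exactly *)
have kinE (v w : R3 R) :
    enorm w ^+ 2 / 2 - enorm v ^+ 2 / 2 - dot v (w - v) =
    1 / 2 * enorm (w - v) ^+ 2.
  by rewrite !sqr_enorm /dot /=; field.
have kin : has_derivative I (fun s => enorm (derive_within I u s) ^+ 2 / 2) t
    (dot (derive_within I u t) (gravity G Omega mu (u t))).
  apply: (has_derivative_comp (F := fun w => enorm w ^+ 2 / 2) (K := 1 / 2)) v'.
  by near=> s; rewrite kinE ger0_norm// mulr_ge0 ?sqr_ge0.
have u_cvg := has_derivative_cvg u'.
have pot : has_derivative I (potential G Omega mu \o u) t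
    (dot (gravity G Omega mu (u t)) (derive_within I u t)).
  apply: (has_derivative_comp
    (K := G * (2 / delta ^+ 3 * mass_int Omega mu (cst 1)))) u'.
  near=> s; apply: potential_expansion => //.
  near: s; exact: (u_cvg _ fard).
rewrite -(subrr (dot (derive_within I u t) (gravity G Omega mu (u t)))).
rewrite [X in _ - X]dotC.
exact: has_derivativeB kin pot.
Unshelve. all: by end_near. Qed.

Lemma energy_conserved I u s t : is_motion G Omega mu I u -> s <= t ->
  [set` `[s, t]] `<=` I -> energy I u s = energy I u t.
Proof.
move=> mo st stI; apply: has_derivative0_cst st _ => x xst.
have xI : I x by exact: stI.
by apply: has_derivative_subset stI _; apply: energy_has_derivative0.
Qed.

End energy.

(** * Largest and smallest distances *)

Section extremal_distances.
Context {R : realType}.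
Implicit Types (A : set (R3 R)) (a p x : R3 R) (r : R).

Lemma max_edist_ge A a r p x : A `<=` closed_eball a r -> A x ->
  enorm (p - x) <= max_edist A p.
Proof.
move=> Ar Ax; apply: ub_le_sup; last by exists x.
exists (enorm (p - a) + r) => _ [y Ay <-].
apply: le_trans (enorm_dist p a y) _; rewrite lerD2l enormB; exact: Ar.
Qed.

Lemma max_edist_le A p d : A !=set0 -> (forall x, A x -> enorm (p - x) <= d) ->
  max_edist A p <= d.
Proof.
move=> [y Ay] Ad; apply: ge_sup; first by exists (enorm (p - y)), y.
by move=> _ [x Ax <-]; exact: Ad.
Qed.

Lemma max_edist_le_max_on A a r p : A !=set0 -> A `<=` closed_eball a r ->
  closed_eball a r p ->
  max_edist A p <= max_on (closed_eball a r) (max_edist A).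
Proof.
move=> A0 Ar pr; apply: ub_le_sup; last by exists p.
exists (r + r) => _ [q qr <-]; apply: max_edist_le => // x Ax.
by apply: le_trans (enorm_dist q a x) _; rewrite lerD// enormB; exact: Ar.
Qed.

Lemma min_edist_le A p x : A x -> min_edist A p <= enorm (p - x).
Proof.
move=> Ax; apply: ge_inf; last by exists x.
by exists 0 => _ [y _ <-]; exact: enorm_ge0.
Qed.

Lemma min_edist_ge A p d : A !=set0 -> (forall x, A x -> d <= enorm (p - x)) ->
  d <= min_edist A p.
Proof.
move=> [y Ay] Ad; apply: lb_le_inf; first by exists (enorm (p - y)), y.
by move=> _ [x Ax <-]; exact: Ad.
Qed.

Lemma min_edist_lt A p d : A !=set0 -> min_edist A p < d ->
  exists2 x, A x & enorm (p - x) < d.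
Proof.
move=> [y Ay] /inf_lt[|_ [x Ax <-] xd]; last by exists x.
by exists (enorm (p - y)), y.
Qed.

End extremal_distances.

(** * Trapping by the potential well *)

Section trapping.
Context {R : realType}.
Variables (G : R) (Omega : set (R3 R)) (mu : R3 R -> R).
Hypothesis G_gt0 : 0 < G.
Hypothesis Omega0 : Omega !=set0.
Hypothesis Omega_open : open Omega.
Hypothesis mu_int : (@lebesgue3 R).-integrable Omega (EFin \o mu).
Hypothesis mu_ge0 : {ae @lebesgue3 R, forall x, Omega x -> 0 <= mu x}.
Let M := \int[@lebesgue3 R]_(x in Omega) mu x.
Hypothesis M_gt0 : 0 < M.

Let mass_intM : mass_int Omega mu (cst 1) = M.
Proof. by apply: eq_Rintegral => x _; rewrite mulr1. Qed.

(** The energy estimate: the motion cannot leave the potential well in which it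
    is found at time [s]. *)
Lemma min_edist_bound I (u : R -> R3 R) (s t V D : R) :
  is_motion G Omega mu I u -> s <= t -> [set` `[s, t]] `<=` I ->
  (forall x, Omega x -> enorm (u s - x) <= D) ->
  enorm (derive_within I u s) <= V -> V ^+ 2 * D < 2 * G * M ->
  min_edist (closure Omega) (u t) <= D / (1 - V ^+ 2 * D / (2 * G * M)).
Proof.
move=> mo st stI usD vV VD; have [nO _ _] := mo.
have Is : I s by apply: stI; rewrite /= in_itv /= lexx.
have It : I t by apply: stI; rewrite /= in_itv /= lexx andbT.
have [ds ds0 fars] := far_near (nO s Is).
have {}fars := nbhs_singleton fars.
(* an infimum of positive distances is positive because closure Omega is
   closed *)
have [dt dt0 fart] : exists2 delta, 0 < delta & far (closure Omega) delta (u t).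
  have [|delta ? /nbhs_singleton] := @far_near _ (closure Omega) (u t).
    by rewrite -(closure_id _).1; [exact: nO|exact: closed_closure].
  by exists delta.
have [y Oy] := Omega0.
have D0 : 0 < D.
  by apply: lt_le_trans (usD y Oy); exact: lt_le_trans ds0 (fars y Oy).
set m := min_edist _ _.
have m0 : 0 < m.
  apply: lt_le_trans dt0 _; apply: min_edist_ge fart.
  by exists y; exact: subset_closure.
have farm : far Omega m (u t).
  by move=> x Ox; apply: min_edist_le; exact: subset_closure.
have psD := potential_ge G_gt0 Omega_open mu_int mu_ge0 ds0 fars usD.
have ptm := potential_le G_gt0 Omega_open mu_int mu_ge0 m0 farm.
rewrite mass_intM in psD ptm.
have vV2 : enorm (derive_within I u s) ^+ 2 <= V ^+ 2.
  by rewrite lerXn2r ?nnegrE ?enorm_ge0// (le_trans (enorm_ge0 _) vV).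
have GM0 : 0 < G * M by exact: mulr_gt0.
have balance (ks kt ps pt : R) : ks <= V ^+ 2 -> 0 <= kt ->
    ks / 2 - ps = kt / 2 - pt -> G * M / D <= ps -> pt <= G * M / m ->
    G * M / D - V ^+ 2 / 2 <= G * M / m by move=> *; lra.
have key : G * M / D - V ^+ 2 / 2 <= G * M / m.
  apply: balance vV2 (sqr_ge0 _) _ psD ptm.
  exact: energy_conserved mo st stI.
have den : 0 < 1 - V ^+ 2 * D / (2 * G * M).
  by rewrite subr_gt0 ltr_pdivrMr ?mul1r// -mulrA mulr_gt0.
(* the claim is [key] multiplied by [m D / (G M)] *)
rewrite ler_pdivlMr// -(ler_pM2l (_ : 0 < G * M / D / m)); last first.
  by rewrite !divr_gt0.
have -> : G * M / D / m * D = G * M / m by field; rewrite !gt_eqF.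
apply: le_trans key.
rewrite le_eqVlt; apply/orP; left; apply/eqP; field.
by rewrite !gt_eqF.
Qed.

End trapping.

(** * Black holes *)

(** The strict inequality is spent in two halves: [D] is the midpoint of [d] and
    [m / c^2], and then [V^2] the midpoint of [c^2] and [m / D]. *)
Lemma sqr_speed_margin (R : realType) (c d m : R) : 0 < c -> 0 <= d ->
  c ^+ 2 * d < m -> exists V D : R, [/\ c < V, d < D & V ^+ 2 * D < m].
Proof.
move=> c0 d0 cdm.
have m0 : 0 < m by apply: le_lt_trans cdm; rewrite mulr_ge0 ?sqr_ge0.
have c20 : 0 < c ^+ 2 by rewrite exprn_gt0.
pose D := (d + m / c ^+ 2) / 2.
have mc : d < m / c ^+ 2 by rewrite ltr_pdivlMr// mulrC.
have dD : d < D by rewrite /D; lra.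
have D0 : 0 < D by exact: le_lt_trans dD.
have cD : c ^+ 2 < m / D.
  rewrite ltr_pdivlMr// mulrC -ltr_pdivlMr// /D; lra.
have half0 : 0 < (c ^+ 2 + m / D) / 2 by lra.
exists (Num.sqrt ((c ^+ 2 + m / D) / 2)), D; split => //.
- rewrite -(@ltr_pXn2r _ 2) ?nnegrE ?sqrtr_ge0 ?(ltW c0)//.
  by rewrite sqr_sqrtr ?(ltW half0)//; lra.
- by rewrite sqr_sqrtr ?(ltW half0)// -ltr_pdivlMr//; lra.
Qed.

Theorem corollary4p1 (R : realType) (Omega : set (R3 R)) (G c : R)
    (mu : R3 R -> R) (M : R) (a : R3 R) (r : R) :
  Omega !=set0 -> ebounded Omega -> open Omega ->
  0 < G -> 0 < c ->
  (@lebesgue3 R).-integrable Omega (EFin \o mu) ->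
  {ae @lebesgue3 R, forall x, Omega x -> 0 <= mu x} ->
  M = \int[@lebesgue3 R]_(x in Omega) mu x -> 0 < M ->
  closure Omega `<=` closed_eball a r ->
  c ^+ 2 * max_on (closed_eball a r) (max_edist (closure Omega)) < 2 * G * M ->
  is_black_hole G Omega mu c (closed_eball a r) /\
  forall (t0 : R) (Tmax : \bar R) (u : R -> R3 R),
    is_maximal_motion G Omega mu t0 Tmax u ->
    closed_eball a r (u t0) -> ~ closure Omega (u t0) ->
    enorm (derive_within (itv_co t0 Tmax) u t0) <= c ->
    forall t, itv_co t0 Tmax t ->
      min_edist (closure Omega) (u t) <=
        max_edist (closure Omega) (u t0) /
        (1 - c ^+ 2 * max_edist (closure Omega) (u t0) / (2 * G * M)).
Proof.
move=> O0 _ oO G0 c0 mu_int mu0 -> M0 Oar cB.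
have cO0 : closure Omega !=set0.
  by have [y Oy] := O0; exists y; exact: subset_closure.
have c2d p : closed_eball a r p ->
    c ^+ 2 * max_edist (closure Omega) p <
    2 * G * \int[@lebesgue3 R]_(x in Omega) mu x.
  move=> ap; apply: le_lt_trans cB; rewrite ler_wpM2l ?sqr_ge0//.
  exact: max_edist_le_max_on.
have far_max p x : Omega x -> enorm (p - x) <= max_edist (closure Omega) p.
  by move=> Ox; apply: max_edist_ge Oar _; exact: subset_closure.
split=> [u0 u0B|t0 T u [_ mo _] u0B _ uc t [t0t tT]]; last first.
  apply: (min_edist_bound G0 O0 oO mu_int mu0 M0 mo t0t _ (far_max _) uc);
    last exact: c2d.
  move=> s; rewrite /= in_itv /= => /andP[t0s st]; split=> //.
  by apply: le_lt_trans tT; rewrite lee_fin.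
have d0 : 0 <= max_edist (closure Omega) u0.
  by have [y Oy] := O0; exact: le_trans (enorm_ge0 _) (far_max u0 y Oy).
have [V [D [cV dD VD]]] := sqr_speed_margin c0 d0 (c2d _ u0B).
exists V => // T u [T0 u_cont uu0 mo speed].
pose K := D / (1 - V ^+ 2 * D / (2 * G * \int[@lebesgue3 R]_(x in Omega) mu x)).
have dist_le t : itv_oo 0 T t -> min_edist (closure Omega) (u t) <= K.
  move=> [t0 tT].
  have u_near : \forall s \near (0 : R)^'+,
      enorm (u s - u0) <= D - max_edist (closure Omega) u0.
    have e0 : 0 < (D - max_edist (closure Omega) u0) / 2.
      by rewrite divr_gt0 ?subr_gt0.
    have zT : itv_co 0 T 0 by [].
    have := (@subspace_continuousP _ _ _ u).1 u_cont _ zT.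
    move=> /cvgrPdist_lt /(_ _ e0); rewrite near_withinE uu0 => us.
    rewrite /at_right near_withinE.
    have lt_t : \forall s \near (0 : R), s < t by exact: lt_nbhsl.
    apply: filterS2 us lt_t => s us st s0.
    rewrite enormB; apply: le_trans (enorm_le_norm _) _.
    rewrite mulrC -ler_pdivlMr//; apply: ltW; apply: us.
    split; first exact: ltW.
    by apply: lt_trans tT; rewrite lte_fin.
  have v_near : \forall s \near (0 : R)^'+,
      enorm (derive_within (itv_oo 0 T) u s) <= V.
    move: speed => /ereal_inf_lt[_ [A A0 <-] supA].
    apply: (@filterS _ _ _ A) => // s As; rewrite -lee_fin.
    by apply: le_trans (ltW supA); apply: ereal_sup_ubound; exists s.
  have [s [st s0 us vs]] : exists s, [/\ s < t, 0 < s,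
      enorm (u s - u0) <= D - max_edist (closure Omega) u0 &
      enorm (derive_within (itv_oo 0 T) u s) <= V].
    apply: (@filter_ex _ (0 : R)^'+); near=> s.
    split; near: s; [exact: nbhs_right_lt|exact: nbhs_right_gt| |].
    - exact: u_near.
    - exact: v_near.
  apply: (min_edist_bound (s := s) G0 O0 oO mu_int mu0 M0 mo (ltW st)) vs VD.
  - move=> q; rewrite /= in_itv /= => /andP[sq qt].
    split; first exact: lt_le_trans sq.
    by apply: le_lt_trans tT; rewrite lee_fin.
  - move=> x Ox; apply: le_trans (enorm_dist _ u0 _) _.
    by rewrite -lerBrDr; apply: le_trans us _; rewrite lerB// far_max.
exists (Num.max (enorm u0) (K + 1 + (enorm a + r))) => _ [t [t0 tT] <-].
move: t0; rewrite le_max le_eqVlt => /predU1P[<-|t0]; first by rewrite uu0 lexx.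
apply/orP; right.
have [x Ox xK] : exists2 x, closure Omega x & enorm (u t - x) < K + 1.
  by apply: min_edist_lt => //; rewrite ltr_pwDr// dist_le.
have -> : u t = (u t - x) + (a + (x - a)) by rewrite [a + _]addrC !subrK.
apply: le_trans (enormD _ _) _; rewrite lerD ?(ltW xK)//.
by apply: le_trans (enormD _ _) _; rewrite lerD2l Oar.
Unshelve. all: by end_near. Qed.
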